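(* For all integers $n,m\ge 0$ such that $n+m>1$, $$M_{2(n+m-1)}^{(2)}-M_{n+m}M_{n+m-2}=2^{n+m-2}.$$
   Context: The Mersenne numbers $(M_n)_{n\ge 0}$ are defined by $M_0=0$, $M_1=1$, $M_{n+2}=3M_{n+1}-2M_n$ for $n\ge 0$. Let $\lambda_1=2$ and $\lambda_2=1$ be the roots of $\lambda^2-3\lambda+2=0$. For integers $n\ge 0$, $k\ge 1$, write uniquely $n=sk+r$ with integers $s\ge 0$ and $0\le r<k$; the generalized $k$-Mersenne number is $M_n^{(k)}=(\lambda_1^{s}-\lambda_2^{s})^{k-r}(\lambda_1^{s+1}-\lambda_2^{s+1})^{r}$. *)

(* Defs.v *)
From mathcomp Require Import all_boot all_order all_algebra.
From mathcomp Require Import ring.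

Set Implicit Arguments.
Unset Strict Implicit.
Unset Printing Implicit Defensive.

Import GRing.Theory.
Local Open Scope ring_scope.

(* Integer-valued, since the recurrence involves a subtraction. *)
Fixpoint mersenne (n : nat) : int :=
  match n with
  | 0%N => 0
  | 1%N => 1
  | (n'.+1 as p).+1 => 3 * mersenne p - 2 * mersenne n'
  end.

Definition lambda1 : int := 2.
Definition lambda2 : int := 1.

Lemma lambda_roots (x : int) :
  (x ^+ 2 - 3 * x + 2 == 0) = (x == lambda1) || (x == lambda2).
Proof.
have -> : x ^+ 2 - 3 * x + 2 = (x - lambda1) * (x - lambda2).
  by rewrite /lambda1 /lambda2; ring.
by rewrite mulf_eq0 !subr_eq0.
Qed.

(* The decomposition n = s k + r with 0 <= r < k is the Euclidean division
   of n by k, so the definition is meaningful only for k >= 1. *)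
Definition gen_mersenne (k n : nat) : int :=
  let s := (n %/ k)%N in
  let r := (n %% k)%N in
  (lambda1 ^+ s - lambda2 ^+ s) ^+ (k - r)
  * (lambda1 ^+ s.+1 - lambda2 ^+ s.+1) ^+ r.

(* Main.v *)
Require Import Defs.
From mathcomp Require Import all_boot all_order all_algebra.
From mathcomp Require Import ring.

(** Both kinds of numbers have closed forms in powers of 2.  The Binet formula
    gives M_j = 2^j - 1 ([mersenne_binet]).  For an index 2 s the division by 2
    leaves no remainder, so the generalized number is a plain square,
    (2^s - 1)^2 = M_s^2 ([gen_mersenne_double]).  The identity is therefore the
    Cassini identity M_(j+1)^2 - M_(j+2) M_j = 2^j at j = n + m - 2
    ([mersenne_cassini]); with a = 2^j it reads
    (2a - 1)^2 - (4a - 1)(a - 1) = a. *)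

Import GRing.Theory.
Local Open Scope ring_scope.

Lemma mersenneSS (j : nat) :
  mersenne j.+2 = 3 * mersenne j.+1 - 2 * mersenne j.
Proof. by []. Qed.

(** The denominator lambda1 - lambda2 of the general Binet formula is 1 here.
    The recurrence has order two, so the induction carries two consecutive
    values. *)
Lemma mersenne_binet (j : nat) : mersenne j = lambda1 ^+ j - lambda2 ^+ j.
Proof.
suff [] : mersenne j = lambda1 ^+ j - lambda2 ^+ j
       /\ mersenne j.+1 = lambda1 ^+ j.+1 - lambda2 ^+ j.+1 by [].
elim: j => [|j [IHj IHj1]]; first by [].
split=> //; rewrite mersenneSS IHj IHj1 !exprS /lambda1 /lambda2; ring.
Qed.

Lemma gen_mersenne_double (s : nat) :
  gen_mersenne 2 (2 * s)%N = mersenne s ^+ 2.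
Proof.
by rewrite /gen_mersenne mulKn // modnMr subn0 expr0 mulr1 mersenne_binet.
Qed.

Lemma mersenne_cassini (j : nat) :
  mersenne j.+1 ^+ 2 - mersenne j.+2 * mersenne j = 2 ^+ j.
Proof.
rewrite !mersenne_binet /lambda1 /lambda2 !expr1n !exprS; ring.
Qed.

Theorem theorem2p3 (n m : nat) (hnm : (1 < n + m)%N) :
  gen_mersenne 2 (2 * (n + m - 1))%N
    - mersenne (n + m)%N * mersenne (n + m - 2)%N
  = 2 ^+ (n + m - 2)%N.
Proof.
rewrite gen_mersenne_double.
case: (n + m)%N hnm => [|[|j]] // _.
by rewrite subn1 subn2; exact: mersenne_cassini.
Qed.
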